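(* Let $\mathcal{A}=\mathcal{B}(\mathcal{X})$ be the Borel $\sigma$-algebra of the metric space $\mathcal{X}$, let $\varepsilon>0$, and assume that for every $x\in\operatorname{supp}(\rho)$: (1) $\mathfrak{m}_x(\mathcal{X}\setminus B_\varepsilon(x))=0$; (2) $B_\varepsilon(x)\subseteq\operatorname{supp}(\mathfrak{m}_x)$; (3) for every $x'\in\operatorname{supp}(\rho)$ the restriction $\mathfrak{m}_{x'}\lfloor_{B_\varepsilon(x)}$ is absolutely continuous with respect to $\mathfrak{m}_x$. With $\Psi_p(t):=\min\{t/p,1\}$ for $p>0$ and $\Psi_0(t):=\mathbf{1}_{t>0}$, one has $$\lim_{p\to0}\min_{A\in\mathcal{A}}\mathrm{R}_{\Psi_p}(A)=\min_{A\in\mathcal{A}}\mathrm{R}_{\Psi_0}(A)=\min_{A\in\mathcal{A}}\mathrm{R}_{\mathrm{adv}}(A)$$ and $$\lim_{p\to0}\min_{A\in\mathcal{A}}\mathrm{ProbR}_{\Psi_p}(A)=\min_{A\in\mathcal{A}}\mathrm{ProbR}_{\Psi_0}(A)=\min_{A\in\mathcal{A}}\mathrm{R}_{\mathrm{adv}}(A).$$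
   Context: Setting: $\mathcal{X}$ is a metric space, $B_\varepsilon(x)$ the open ball of radius $\varepsilon$ around $x$, $\mathcal{A}=\mathcal{B}(\mathcal{X})$, and $\mu$ a probability measure on $(\mathcal{X}\times\{0,1\},\mathcal{A}\otimes 2^{\{0,1\}})$. For $i\in\{0,1\}$ put $\rho_i(B):=\mu(B\times\{i\})$, and $\rho:=\rho_0+\rho_1$. $\{\mathfrak{m}_x\}_{x\in\mathcal{X}}$ is a family of Borel probability measures on $\mathcal{X}$ with $x\mapsto\mathfrak{m}_x(B)$ measurable for every $B\in\mathcal{A}$. $\operatorname{supp}$ denotes the support of a Borel measure (the set of points all of whose open neighborhoods have positive measure); $\rho$ is concentrated on its support, $\rho(\mathcal{X}\setminus\operatorname{supp}(\rho))=0$ (automatic if $\mathcal{X}$ is separable). For $\Psi:[0,1]\to[0,1]$ and $A\in\mathcal{A}$ (with $A^c=\mathcal{X}\setminus A$): $$\mathrm{R}_\Psi(A):=\int_{\mathcal{X}}\Psi(\mathfrak{m}_x(A))\,d\rho_0(x)+\int_{\mathcal{X}}\Psi(\mathfrak{m}_x(A^c))\,d\rho_1(x),$$ $$\mathrm{ProbR}_\Psi(A):=\rho_0(A)+\rho_1(A^c)+\int_{A^c}\Psi(\mathfrak{m}_x(A))\,d\rho_0(x)+\int_{A}\Psi(\mathfrak{m}_x(A^c))\,d\rho_1(x),$$ $$\mathrm{R}_{\mathrm{adv}}(A):=\int_{\mathcal{X}}\sup_{\tilde x\in B_\varepsilon(x)}\mathbf{1}_A(\tilde x)\,d\rho_0(x)+\int_{\mathcal{X}}\sup_{\tilde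 x\in B_\varepsilon(x)}\mathbf{1}_{A^c}(\tilde x)\,d\rho_1(x).$$ *)

(* Defs.v *)
From HB Require Import structures.
From mathcomp Require Import all_boot all_order all_algebra.
From mathcomp Require Import all_classical all_reals all_analysis.

Set Implicit Arguments.
Unset Strict Implicit.
Unset Printing Implicit Defensive.

Import Order.TTheory GRing.Theory Num.Theory.
Import numFieldNormedType.Exports.

Local Open Scope classical_set_scope.
Local Open Scope ring_scope.

(* A [measurableType] has to be pointed, a [metricType] need not be; the
   point itself plays no role.  Nonemptiness is no restriction for a space
   carrying a probability measure. *)
#[short(type="pointedMetricType")]
HB.structure Definition PointedMetric (K : numDomainType) :=
  {M of Pointed M & Metric K M}.

Definition borel {R : realType} (X : pointedMetricType R) :=
  g_sigma_algebraType (@open X).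

Section borel.
Context {R : realType} {X : pointedMetricType R}.

Lemma measurable_borel_ball (x : X) (e : R) :
  measurable (ball x e : set (borel X)).
Proof.
apply: sub_sigma_algebra; rewrite /= openE => y.
rewrite ballEmdist /= => xy; apply/nbhs_ballP.
exists (e - mdist x y); first by rewrite /= subr_gt0.
move=> z; rewrite !ballEmdist /= => yz.
by rewrite (le_lt_trans (metric_triangle _ y _))// -ltrBrDl.
Qed.

Definition supp (nu : set (borel X) -> \bar R) : set X :=
  [set x | forall U : set X, open U -> U x -> (0 < nu U)%E].

End borel.

Section class_measure.
Context {R : realType} {X : pointedMetricType R}.
Variable mu : {measure set (borel X * bool)%type -> \bar R}.

(* The label 0 is [false] and the label 1 is [true]. *)
Definition rho_ (i : bool) (B : set (borel X)) : \bar R := mu (B `*` [set i]).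

Variable i : bool.

Let rho_set0 : rho_ i set0 = 0%E.
Proof. by rewrite /rho_ set0X measure0. Qed.

Let rho_ge0 B : (0 <= rho_ i B)%E.
Proof. exact: measure_ge0. Qed.

Let rho_sigma_additive : semi_sigma_additive (rho_ i).
Proof.
move=> F mF tF mUF; rewrite /rho_.
have -> : (\bigcup_n F n) `*` [set i] = \bigcup_n (F n `*` [set i]).
  apply/seteqP; split=> [[x j] [[n _ Fnx] ij]|[x j] [n _ [Fnx ij]]].
    by exists n.
  by split=> //; exists n.
have mFi n : measurable (F n `*` [set i]) by exact: measurableX.
apply: measure_semi_sigma_additive => //; last exact: bigcup_measurable.
apply/trivIsetP => n k _ _ nk.
move/trivIsetP : tF => /(_ n k Logic.I Logic.I nk) FnFk.
by rewrite -setXI FnFk set0X.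
Qed.

HB.instance Definition _ := isMeasure.Build _ _ _ (rho_ i)
  rho_set0 rho_ge0 rho_sigma_additive.

End class_measure.

Definition rho {R : realType} {X : pointedMetricType R}
    (mu : {measure set (borel X * bool)%type -> \bar R}) :=
  measure_add (rho_ mu false) (rho_ mu true).

Section risks.
Context {R : realType} {X : pointedMetricType R}.
Variable mu : {measure set (borel X * bool)%type -> \bar R}.
Local Open Scope ereal_scope.

Definition risk (m : borel X -> {measure set (borel X) -> \bar R})
    (Psi : R -> R) (A : set (borel X)) : \bar R :=
  \int[rho_ mu false]_x (Psi (fine (m x A)))%:E +
  \int[rho_ mu true]_x (Psi (fine (m x (~` A))))%:E.

Definition prob_risk (m : borel X -> {measure set (borel X) -> \bar R})
    (Psi : R -> R) (A : set (borel X)) : \bar R :=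
  rho_ mu false A + rho_ mu true (~` A) +
  \int[rho_ mu false]_(x in ~` A) (Psi (fine (m x A)))%:E +
  \int[rho_ mu true]_(x in A) (Psi (fine (m x (~` A))))%:E.

Definition adv_risk (eps : R) (A : set (borel X)) : \bar R :=
  \int[rho_ mu false]_x
    ereal_sup [set (\1_A y)%:E | y in ball (x : X) eps] +
  \int[rho_ mu true]_x
    ereal_sup [set (\1_(~` A) y)%:E | y in ball (x : X) eps].

End risks.

Section psi.
Context {R : realType}.

(* Only meaningful for [0 < p]: since [t / 0 = 0], [Psi 0] is not [Psi0]. *)
Definition Psi (p t : R) : R := Num.min (t / p) 1.

Definition Psi0 (t : R) : R := (0 < t)%R%:R.

End psi.

Section minima.
Context {R : realType} {X : pointedMetricType R}.
Variable J : set (borel X) -> \bar R.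

Definition attains_min :=
  exists2 A, measurable A & forall B, measurable B -> (J A <= J B)%E.

(* The minimum of [J] over the Borel sets, provided [attains_min] holds. *)
Definition min_val : \bar R := ereal_inf [set J A | A in measurable].

End minima.

(* Main.v *)
Require Import Defs.
From HB Require Import structures.
From mathcomp Require Import all_boot all_order all_algebra.
From mathcomp Require Import all_classical all_reals all_analysis.
From mathcomp Require Import measurable_realfun lra.

Set Implicit Arguments.
Unset Strict Implicit.
Unset Printing Implicit Defensive.

Import Order.TTheory GRing.Theory Num.Theory.
Import numFieldNormedType.Exports.

Local Open Scope classical_set_scope.
Local Open Scope ring_scope.

(* The integrands of all these risks are, for fixed [x], nondecreasing and
   submodular in the set and continuous along increasing sequences of sets:
   [Psi p] is concave, nondecreasing and continuous.  Hence [risk] and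
   [prob_risk] with [Psi p] are submodular and lower semicontinuous along
   monotone sequences of sets.  This replaces compactness: if [A n] nearly
   minimizes the risk for [p = 1 / (n + 1)], submodularity bounds the risk of
   [A n `|` ... `|` A (n + k)] uniformly in [k], and the limes superior of [A]
   has risk at most [L := sup_p min_A risk_p A] for every [p], hence risk at
   most [L] for [Psi0].  As [L] is at most the minimum for [Psi0], this gives
   both the minimizers and the convergence.

   On [supp (rho mu)] the losses satisfy risk <= prob_risk <= adversarial.
   Conversely, let [A'] be the union of the balls [ball x eps] over the [x] in
   the support with [m x (~` A) = 0]; by absolute continuity [A'] misses
   [ball x eps] whenever [m x A = 0], so the adversarial risk of [A'] is at most
   the [Psi0]-risk of [A]. *)

(** * Common near-minimizers for an increasing sequence of submodular set functions *)

Section submodular_minimization.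
Context d (T : measurableType d) (R : realType).
Implicit Types (J Phi : set T -> \bar R) (F : (set T)^nat).
Local Open Scope ereal_scope.

Definition submodular J := forall A B, measurable A -> measurable B ->
  J (A `|` B) + J (A `&` B) <= J A + J B.

Definition lsc_bigcup J := forall F, (forall n, measurable (F n)) ->
  (forall n, F n `<=` F n.+1) ->
  J (\bigcup_n F n) <= ereal_sup (range (fun n => J (F n))).

Definition lsc_bigcap J := forall F, (forall n, measurable (F n)) ->
  (forall n, F n.+1 `<=` F n) ->
  J (\bigcap_n F n) <= ereal_sup (range (fun n => J (F n))).

(* With [A n] a [2^-n]-minimizer of [J n], submodularity gives
   [J n (A n `|` ... `|` A (n + k)) <= L + 2^(1 - n)] for all [k]; the limes
   superior of the sequence [A] is the required set. *)
Lemma submodular_common_minimizer (J : nat -> set T -> \bar R)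
    (l : nat -> R) (L : R) :
  (forall n, submodular (J n)) ->
  (forall n, lsc_bigcup (J n)) -> (forall n, lsc_bigcap (J n)) ->
  (forall n A, measurable A -> J n A <= J n.+1 A) ->
  (forall n A, measurable A -> (l n)%:E <= J n A) ->
  (forall n (e : R), (0 < e)%R ->
    exists2 A, measurable A & J n A <= (l n + e)%:E) ->
  (forall n, l n <= L)%R ->
  exists2 B, measurable B & forall n, J n B <= L%:E.
Proof.
move=> Jsub Jcup Jcap Jnd lJ Jl lL.
(* Halving makes the errors close up: [eps n] plus twice [eps n.+1] is twice [eps n], the bound in
   [JC]. *)
pose eps (n : nat) : R := (2^-1 ^+ n)%R.
have eps_gt0 n : (0 < eps n)%R by rewrite exprn_gt0// invr_gt0.
have epsS n : eps n = (eps n.+1 *+ 2)%R.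
  by rewrite /eps exprS; lra.
have /choice[A AP] n : exists A, measurable A /\ J n A <= (l n + eps n)%:E.
  by have [A mA JA] := Jl n (eps n) (eps_gt0 n); exists A.
(* [C n k] is the union of [A n] up to [A (n + k)]. Recursion on the left end lets the induction in
   [JC] pass from [J n.+1] to [J n]. *)
pose C := fix C n k := if k is k'.+1 then A n `|` C n.+1 k' else A n.
have mC n k : measurable (C n k).
  elim: k n => [|k IHk] n /=; first by have [] := AP n.
  by apply: measurableU => //; have [] := AP n.
have JC n k : J n (C n k) <= (L + eps n *+ 2)%:E.
  elim: k n => [|k IHk] n /=.
    have [_ /le_trans->//] := AP n.
    by rewrite lee_fin lerD// mulr2n lerDl ltW.
  have [mA JA] := AP n.
  (* The intersection costs at least [l n], which cancels the [l n] in the bound for [A n] once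
     submodularity is applied. *)
  have lAC : (l n)%:E <= J n (A n `&` C n.+1 k).
    by apply: lJ; exact: measurableI.
  have := Jsub n _ _ mA (mC n.+1 k).
  move=> /(le_trans (leeD2l _ lAC)).
  move=> /le_trans/(_ (leeD JA (le_trans (Jnd n _ (mC n.+1 k)) (IHk n.+1)))).
  rewrite -EFinD -leeBrDr// -EFinB => /le_trans; apply.
  rewrite lee_fin -epsS mulr2n.
  by rewrite [leLHS](_ : _ = L + (eps n + eps n))%R//; lra.
have CS n k : C n k `<=` C n k.+1.
  by elim: k n => [|k IHk] n /= x; [left|case=> [|/IHk]; [left|right]].
pose B n := \bigcup_k C n k.
have mB n : measurable (B n) by exact: bigcup_measurable.
have BS n : B n.+1 `<=` B n by move=> x [k _ Cx]; exists k.+1 => //; right.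
have JB n : J n (B n) <= (L + eps n *+ 2)%:E.
  apply: (le_trans (Jcup n _ (mC n) (CS n))).
  by apply: ge_ereal_sup => _ [k _ <-].
have Jmono A' m n : measurable A' -> (m <= n)%N -> J m A' <= J n A'.
  move=> mA'; apply: (@homo_leq _ (fun k => J k A') (fun x y => x <= y)) => //.
    by move=> y x z; exact: le_trans.
  by move=> i; exact: Jnd.
exists (\bigcap_n B n); first exact: bigcap_measurable.
move=> m; apply/lee_addgt0Pr => e e_gt0.
have [n mn epsn] : exists2 n, (m <= n)%N & (eps n *+ 2 <= e)%R.
  have /cvgrPdist_le/(_ (e / 2)%R) : eps n @[n --> \oo] --> (0 : R)%R.
    by apply: cvg_expr; rewrite ger0_norm ?invr_ge0// invf_lt1 ?ltr1n.
  have e2_gt0 : (0 < e / 2)%R by rewrite divr_gt0.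
  move=> /(_ e2_gt0)[N _ /(_ (maxn m N))/=].
  rewrite leq_maxr => /(_ isT); rewrite sub0r normrN gtr0_norm// => h.
  exists (maxn m N); first exact: leq_maxl.
  by rewrite -mulr_natr -ler_pdivlMr.
(* Since [B] decreases, its first [n] sets may be dropped; on the others [J m] is bounded by
   [J (n + k)] and the error is at most [e]. *)
have -> : \bigcap_k B k = \bigcap_k B (n + k)%N.
  apply/seteqP; split=> [x Bx k _|x Bx k _]; first exact: Bx.
  have BD i j : B (i + j)%N `<=` B i.
    elim: j => [|j IHj]; first by rewrite addn0.
    by rewrite addnS; apply: subset_trans IHj; exact: BS.
  by apply: (BD k n); rewrite addnC; exact: Bx.
apply: (le_trans (Jcap m (fun k => B (n + k)%N) _ _)) => //.
  by move=> k; rewrite addnS; exact: BS.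
apply: ge_ereal_sup => _ [k _ <-].
apply: (le_trans (Jmono _ m (n + k)%N (mB _) _)).
  by rewrite (leq_trans mn)// leq_addr.
rewrite (le_trans (JB _))// lee_fin lerD2l (le_trans _ epsn)//.
rewrite lerMn2r/= /eps exprD ler_piMr ?exprn_ge0 ?invr_ge0//.
by rewrite exprn_ile1 ?invr_ge0// invf_le1 ?ler1n.
Qed.

End submodular_minimization.

(** * Integrals of capacities, and sums of a capacity with a complemented one *)

Section capacities.
Context d (T : measurableType d) (R : realType).
Implicit Types (Phi : set T -> \bar R) (A B : set T).
Local Open Scope ereal_scope.

(** The class of pointwise losses that survives integration. Continuity along increasing sequences
    is stated as one inequality; the other follows from monotonicity. *)
Definition capacity Phi := [/\ forall A, measurable A -> 0 <= Phi A,
  forall A B, measurable A -> measurable B -> A `<=` B -> Phi A <= Phi B,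
  submodular Phi & lsc_bigcup Phi].

(** Nonnegativity rules out [+oo - oo], so the suprema, being limits, add up. *)
Lemma ereal_supD_nondecreasing (u v : (\bar R)^nat) :
  nondecreasing_seq u -> nondecreasing_seq v ->
  (forall n, 0 <= u n) -> (forall n, 0 <= v n) ->
  ereal_sup (range u) + ereal_sup (range v) =
  ereal_sup (range (fun n => u n + v n)).
Proof.
move=> ndu ndv u0 v0.
have sup_ge0 (w : (\bar R)^nat) :
    (forall n, 0 <= w n) -> 0 <= ereal_sup (range w).
  move=> w0; apply: (le_trans (w0 0%N)).
  by apply: ereal_sup_ubound; exists 0%N.
have uv := cvgeD (ge0_adde_def (sup_ge0 _ u0) (sup_ge0 _ v0))
  (ereal_nondecreasing_cvgn ndu) (ereal_nondecreasing_cvgn ndv).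
rewrite -(cvg_lim (@ereal_hausdorff R) (uv _)).
apply: (cvg_lim (@ereal_hausdorff R)).
by apply: ereal_nondecreasing_cvgn => m n mn; rewrite leeD ?ndu ?ndv.
Qed.

(** Monotone convergence: the pointwise supremum of the nondecreasing [g n] is their limit. *)
Lemma le_integral_sup (mu : {measure set T -> \bar R}) (f : T -> \bar R)
    (g : (T -> \bar R)^nat) :
  measurable_fun setT f -> (forall n, measurable_fun setT (g n)) ->
  (forall x, 0 <= f x) -> (forall n x, 0 <= g n x) ->
  (forall x, nondecreasing_seq (g ^~ x)) ->
  (forall x, f x <= ereal_sup (range (g ^~ x))) ->
  \int[mu]_x f x <= ereal_sup (range (fun n => \int[mu]_x g n x)).
Proof.
move=> mf mg f0 g0 ndg fg.
have ndI : nondecreasing_seq (fun n => \int[mu]_x g n x).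
  by move=> m n mn; apply: ge0_le_integral => // x _; exact: ndg.
rewrite -(cvg_lim (@ereal_hausdorff R) (ereal_nondecreasing_cvgn ndI)).
rewrite -monotone_convergence//.
have limE x : limn (g ^~ x) = ereal_sup (range (g ^~ x)).
  exact: (cvg_lim (@ereal_hausdorff R) (ereal_nondecreasing_cvgn (ndg x))).
apply: ge0_le_integral => //.
- apply: (@emeasurable_fun_cvg _ _ _ _ g) => // x _; rewrite limE.
  exact: ereal_nondecreasing_cvgn.
- by move=> x _; rewrite limE.
Qed.

Lemma subset_homo (F : (set T)^nat) : (forall n, F n `<=` F n.+1) ->
  forall m n, (m <= n)%N -> F m `<=` F n.
Proof.
move=> FS; apply: (@homo_leq _ F (fun A B => A `<=` B)) => [A|B A C|//].
  exact: subset_refl.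
exact: subset_trans.
Qed.

(** Submodularity passes through the integral by additivity, continuity from below by monotone
    convergence. *)
Lemma integral_capacity (mu : {measure set T -> \bar R})
    (f : T -> set T -> \bar R) :
  (forall A, measurable A -> measurable_fun setT (f ^~ A)) ->
  (forall x, capacity (f x)) -> capacity (fun A => \int[mu]_x f x A).
Proof.
move=> mf fc; have f0 x A : measurable A -> 0 <= f x A.
  by have [+ _ _ _] := fc x; exact.
split.
- by move=> A mA; apply: integral_ge0 => x _; exact: f0.
- move=> A B mA mB AB; apply: ge0_le_integral => //;
    [by move=> x _; exact: f0|exact: mf..|].
  by move=> x _; have [_ + _ _] := fc x; exact.
- move=> A B mA mB.
  have mU := measurableU _ _ mA mB; have mI := measurableI _ _ mA mB.
  rewrite -!ge0_integralD//; try (by move=> x _; exact: f0); try exact: mf.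
  apply: ge0_le_integral => //.
  + by move=> x _; rewrite adde_ge0// f0.
  + by apply: emeasurable_funD; exact: mf.
  + by apply: emeasurable_funD; exact: mf.
  + by move=> x _; have [_ _ + _] := fc x; exact.
- move=> F mF FS; have mUF := bigcup_measurable (fun n _ => mF n).
  apply: le_integral_sup => //.
  + exact: mf.
  + by move=> n; exact: mf.
  + by move=> x; exact: f0.
  + by move=> n x; exact: f0.
  + move=> x m n mn; have [_ + _ _] := fc x; apply=> //.
    exact: subset_homo mn.
  + by move=> x; have [_ _ _ +] := fc x; exact.
Qed.

(** Complementation exchanges unions and intersections. *)
Lemma submodular_add_compl Phi Phi' : submodular Phi -> submodular Phi' ->
  submodular (fun A => Phi A + Phi' (~` A)).
Proof.
move=> sPhi sPhi' A B mA mB; rewrite setCU setCI addeACA [leRHS]addeACA.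
apply: leeD; first exact: sPhi.
by rewrite addeC; apply: sPhi'; exact: measurableC.
Qed.

(** Along an increasing sequence [Phi] is continuous, while the complements decrease and
    monotonicity bounds the limit value of [Phi'] by each term. *)
Lemma lsc_bigcup_add_compl Phi Phi' : capacity Phi -> capacity Phi' ->
  lsc_bigcup (fun A => Phi A + Phi' (~` A)).
Proof.
move=> [Phi0 Phind _ Phic] [Phi'0 Phi'nd _ _] F mF FS.
have mUF := bigcup_measurable (fun n _ => mF n).
(* The limit value of [Phi'] becomes the supremum of a constant sequence, so that both terms merge
   into one supremum. *)
apply: (@le_trans _ _ (ereal_sup (range (fun n => Phi (F n))) +
    ereal_sup (range (fun _ : nat => Phi' (~` \bigcup_n F n))))).
  apply: leeD; first exact: Phic.
  by apply: ereal_sup_ubound; exists 0%N.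
rewrite ereal_supD_nondecreasing//.
- apply: ge_ereal_sup => _ [n _ <-].
  apply: (@le_trans _ _ (Phi (F n) + Phi' (~` F n))).
    apply: leeD => //; apply: Phi'nd; [exact: measurableC..|].
    by apply: subsetC => x Fx; exists n.
  by apply: ereal_sup_ubound; exists n.
- by move=> m n mn; apply: Phind => //; exact: subset_homo mn.
- by move=> n; exact: Phi0.
- by move=> n; apply: Phi'0; exact: measurableC.
Qed.

(** Passing to complements swaps the roles of [Phi] and [Phi'] and makes the decreasing sequence
    increasing. *)
Lemma lsc_bigcap_add_compl Phi Phi' : capacity Phi -> capacity Phi' ->
  lsc_bigcap (fun A => Phi A + Phi' (~` A)).
Proof.
move=> cPhi cPhi' F mF FS.
have -> : \bigcap_n F n = ~` \bigcup_n ~` F n.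
  by rewrite setC_bigcup; apply: eq_bigcapr => n _; rewrite setCK.
rewrite setCK addeC.
apply: (le_trans (lsc_bigcup_add_compl cPhi' cPhi (fun n => measurableC (mF n))
  (fun n => subsetC (FS n)))).
apply: ge_ereal_sup => _ [n _ <-]; rewrite setCK addeC.
by apply: ereal_sup_ubound; exists n.
Qed.

(** This serves the loss of [prob_risk]. The bound by 1 keeps it monotone; if [x] lies in exactly
    one of [A] and [B], submodularity reduces to monotonicity of [Phi]. *)
Lemma capacity_mem (x : T) Phi : capacity Phi ->
  (forall A, measurable A -> Phi A <= 1) ->
  capacity (fun A => if x \in A then 1 else Phi A).
Proof.
move=> [Phi0 Phind Phisub Phic] Phi1; split.
- by move=> A mA; case: ifPn => // _; exact: Phi0.
- move=> A B mA mB AB; case: ifPn => [|_]; case: ifPn => //.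
  + by rewrite inE notin_setE => nBx /AB.
  + by move=> _; exact: Phi1.
  + by move=> _; exact: Phind.
- move=> A B mA mB; rewrite in_setU in_setI.
  have mI := measurableI _ _ mA mB.
  case: (x \in A); case: (x \in B) => //=.
  + by apply: leeD => //; apply: Phind.
  + by rewrite [leRHS]addeC; apply: leeD => //; apply: Phind.
  + exact: Phisub.
- move=> F mF FS; case: ifPn => [|nx].
    rewrite inE => -[n _ Fnx]; apply: ereal_sup_ubound.
    by exists n => //; rewrite mem_set.
  apply: (le_trans (Phic F mF FS)); apply: ge_ereal_sup => _ [n _ <-].
  apply: (@le_trans _ _ (if x \in F n then 1 else Phi (F n))).
    by case: ifPn => // _; exact: Phi1.
  by apply: ereal_sup_ubound; exists n.
Qed.

End capacities.

(** * Existence of minimizers and convergence of minima as the parameter tends to 0 *)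

Section parametrized_minimization.
Context {R : realType} {X : pointedMetricType R}.
Implicit Types J : set (borel X) -> \bar R.
Local Open Scope ereal_scope.

Lemma min_val_le J A : measurable A -> min_val J <= J A.
Proof. by move=> mA; apply: ereal_inf_lbound; exists A. Qed.

Lemma attains_minP J A : measurable A -> J A <= min_val J -> attains_min J.
Proof.
by move=> mA JA; exists A => // B mB; rewrite (le_trans JA)// min_val_le.
Qed.

Lemma min_val_fin_num J : (forall A, measurable A -> 0 <= J A) ->
  J set0 < +oo -> min_val J \is a fin_num.
Proof.
move=> J0 Joo; rewrite ge0_fin_numE.
  by rewrite (le_lt_trans _ Joo)// min_val_le.
by apply: le_ereal_inf_tmp => _ [A mA <-]; exact: J0.
Qed.

Lemma min_val_adherent J (e : R) : min_val J \is a fin_num -> (0 < e)%R ->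
  exists2 A, measurable A & J A <= (fine (min_val J) + e)%:E.
Proof.
move=> Jfin e_gt0; have [_ [A mA <-] JA] := lb_ereal_inf_adherent e_gt0 Jfin.
by exists A => //; rewrite EFinD fineK// ltW.
Qed.

(** For a constant sequence of functionals, with [L] the infimum itself, the common set is a
    minimizer. *)
Lemma submodular_attains_min J : submodular J -> lsc_bigcup J ->
  lsc_bigcap J -> min_val J \is a fin_num -> attains_min J.
Proof.
move=> Jsub Jcup Jcap Jfin.
have [//|||//|B mB /(_ 0%N)] := @submodular_common_minimizer _ _ _
  (fun=> J) (fun=> fine (min_val J)) (fine (min_val J)) (fun=> Jsub)
  (fun=> Jcup) (fun=> Jcap).
- by move=> _ A mA; rewrite fineK// min_val_le.
- by move=> _ e; exact: min_val_adherent.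
- by rewrite fineK//; exact: attains_minP.
Qed.

(** On measurable sets [J0] is the supremum of the family [J p], which grows as [p] decreases. A
    common set for all [p = 1 / (n + 1)] shows that supremum and minimum may be exchanged. *)
Lemma min_val_cvg_at_right (J : R -> set (borel X) -> \bar R) J0 :
  (forall p, (0 < p)%R ->
    [/\ submodular (J p), lsc_bigcup (J p) & lsc_bigcap (J p)]) ->
  (forall p A, (0 < p)%R -> measurable A -> 0 <= J p A) ->
  (forall p q A, (0 < q)%R -> (q <= p)%R -> measurable A -> J p A <= J q A) ->
  (forall p A, (0 < p)%R -> measurable A -> J p A <= J0 A) ->
  (forall A, measurable A ->
    J0 A <= ereal_sup (range (fun n => J n.+1%:R^-1%R A))) ->
  J0 set0 < +oo ->
  [/\ forall p, (0 < p)%R -> attains_min (J p), attains_min J0 &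
      min_val (J p) @[p --> (0 : R)%R^'+] --> min_val J0].
Proof.
move=> Jc J_ge0 Jmono JJ0 J0sup J0oo.
have min_mono p q : (0 < q)%R -> (q <= p)%R -> min_val (J p) <= min_val (J q).
  move=> q0 qp; apply: le_ereal_inf_tmp => _ [A mA <-].
  by rewrite (le_trans (min_val_le _ mA))// Jmono.
have min_le p : (0 < p)%R -> min_val (J p) <= min_val J0.
  move=> p0; apply: le_ereal_inf_tmp => _ [A mA <-].
  by rewrite (le_trans (min_val_le _ mA))// JJ0.
have Jfin p : (0 < p)%R -> min_val (J p) \is a fin_num.
  move=> p0; apply: min_val_fin_num => [A mA|]; first exact: J_ge0.
  by rewrite (le_lt_trans _ J0oo)// JJ0.
have J0fin : min_val J0 \is a fin_num.
  apply: min_val_fin_num => // A mA.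
  by rewrite (le_trans (J_ge0 1%R _ ltr01 mA))// JJ0.
pose s := ereal_sup (range (fun n => min_val (J n.+1%:R^-1%R))).
have inv_gt0 n : (0 < n.+1%:R^-1 :> R)%R by rewrite invr_gt0.
have sJ0 : s <= min_val J0 by apply: ge_ereal_sup => _ [n _ <-]; exact: min_le.
have Js n : min_val (J n.+1%:R^-1%R) <= s by apply: ereal_sup_ubound; exists n.
have sfin : s \is a fin_num.
  rewrite fin_numE -ltNye -ltey; apply/andP; split.
    by apply: (lt_le_trans _ (Js 0%N)); rewrite ltNye_eq Jfin.
  by rewrite (le_lt_trans sJ0)// ltey_eq J0fin.
have [B mB J0B] : exists2 B, measurable B & J0 B <= s.
  have [n|n|n|n A mA|n A mA|n e|n|B mB JB] := @submodular_common_minimizer _ _ _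
    (fun n => J n.+1%:R^-1%R) (fun n => fine (min_val (J n.+1%:R^-1%R)))
    (fine s).
  - by have [] := Jc _ (inv_gt0 n).
  - by have [] := Jc _ (inv_gt0 n).
  - by have [] := Jc _ (inv_gt0 n).
  - by apply: Jmono => //; rewrite lef_pV2 ?posrE// ler_nat.
  - by rewrite fineK ?Jfin// min_val_le.
  - by apply: min_val_adherent; exact: Jfin.
  - by rewrite fine_le ?Jfin.
  - exists B => //; apply: (le_trans (J0sup B mB)).
    by apply: ge_ereal_sup => _ [n _ <-]; rewrite -(fineK sfin).
have min0E : min_val J0 = s.
  by apply/eqP; rewrite eq_le sJ0 andbT (le_trans (min_val_le _ mB)).
split.
- move=> p p0; have [? ? ?] := Jc p p0.
  exact: submodular_attains_min (Jfin _ p0).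
- by apply: (attains_minP mB); rewrite min0E.
(* By monotonicity in [p] the limit from the right at 0 is the supremum over all [0 < p]; it lies
   between [s] and [min_val J0], which coincide. *)
- rewrite (_ : min_val J0 =
    ereal_sup [set min_val (J p) | p in [set` Interval (BRight 0%R) +oo%O]]).
    apply: nonincreasing_at_right_cvge => // p q.
    by rewrite !in_itv/= !andbT => p0 q0 pq; exact: min_mono.
  apply/eqP; rewrite eq_le; apply/andP; split.
    rewrite min0E; apply: ge_ereal_sup => _ [n _ <-].
    apply: ereal_sup_ubound; exists n.+1%:R^-1%R => //=.
    by rewrite in_itv/= andbT.
  apply: ge_ereal_sup => _ [p + <-]; rewrite /= in_itv/= andbT.
  exact: min_le.
Qed.

End parametrized_minimization.

(** * The truncated linear functions [Psi p] and their limit [Psi0] *)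

Section psi_properties.
Context {R : realType}.
Implicit Types p q s t : R.

Lemma Psi_homo p : 0 < p -> {homo Psi p : s t / s <= t}.
Proof.
move=> p0 s t st; rewrite /Psi le_min !ge_min lexx orbT andbT.
by rewrite ler_wpM2r// invr_ge0 ltW.
Qed.

Lemma Psi_ge0 p t : 0 < p -> 0 <= t -> 0 <= Psi p t.
Proof. by move=> p0 t0; rewrite /Psi le_min ler01 andbT divr_ge0// ltW. Qed.

Lemma Psi_le1 p t : Psi p t <= 1.
Proof. by rewrite /Psi ge_min lexx orbT. Qed.

Lemma Psi_anti p q t : 0 < q -> q <= p -> 0 <= t -> Psi p t <= Psi q t.
Proof.
move=> q0 qp t0; rewrite /Psi le_min !ge_min lexx orbT andbT.
rewrite ler_wpM2l// lef_pV2// posrE.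
exact: lt_le_trans qp.
Qed.

Lemma Psi0_homo : {homo @Psi0 R : s t / s <= t}.
Proof.
move=> s t st; rewrite /Psi0 ler_nat.
by have [s0|//] := ltP 0 s; rewrite (lt_le_trans s0 st).
Qed.

Lemma Psi_le_Psi0 p t : 0 < p -> 0 <= t -> Psi p t <= Psi0 t.
Proof.
move=> p0; rewrite le_eqVlt => /predU1P[<-|t0].
  by rewrite /Psi /Psi0 mul0r ltxx min_l.
by rewrite /Psi0 t0 Psi_le1.
Qed.

(** A single term suffices: at 0 both sides vanish, and for [0 < t] the value 1 is reached once
    [n + 1] exceeds [t^-1]. *)
Lemma Psi0_le_sup t : 0 <= t ->
  ((Psi0 t)%:E <= ereal_sup (range (fun n => (Psi n.+1%:R^-1 t)%:E)))%E.
Proof.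
rewrite le_eqVlt => /predU1P[<-|t0].
  apply: ereal_sup_ubound; exists 0%N => //.
  by rewrite /Psi /Psi0 mul0r ltxx min_l.
pose n := Num.truncn t^-1; apply: ereal_sup_ubound; exists n => //.
rewrite /Psi /Psi0 t0 invrK min_r// -ler_pdivrMl// mulr1 ltW//.
by rewrite truncnS_gt.
Qed.

(** Concavity in four-point form: [s] and [t] lie between [a] and [b] and have the same sum. In the
    application [a] and [b] are the measures of an intersection and a union. *)
Lemma Psi_submodular p a b s t : 0 < p -> a <= s -> a <= t -> b + a = s + t ->
  Psi p b + Psi p a <= Psi p s + Psi p t.
Proof.
move=> p0 as_ at_ bast; rewrite /Psi.
have : b / p + a / p = s / p + t / p by rewrite -!mulrDl bast.
have : a / p <= s / p by rewrite ler_pM2r ?invr_gt0.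
have : a / p <= t / p by rewrite ler_pM2r ?invr_gt0.
rewrite /Num.min; do 4! case: ifPn; lra.
Qed.

Lemma Psi_continuous p : continuous (Psi p).
Proof.
move=> t; apply: (@continuous_min R R^o (fun t => t / p) (cst 1)).
  by apply: cvgM; [exact: cvg_id|exact: cvg_cst].
exact: cvg_cst.
Qed.

End psi_properties.

(** [P] is modular, so concavity of [Psi p] yields submodularity; continuity from below of [P] and
    continuity of [Psi p] yield the limit property. *)
Lemma Psi_capacity d (T : measurableType d) (R : realType)
    (P : {measure set T -> \bar R}) (p : R) :
  (P [set: T] < +oo)%E -> 0 < p ->
  capacity (fun A => (Psi p (fine (P A)))%:E).
Proof.
move=> PT p0.
have Pfin A : measurable A -> P A \is a fin_num.
  by move=> mA; rewrite ge0_fin_numE// (le_lt_trans _ PT)// le_measure ?inE.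
have Ple A B : measurable A -> measurable B -> A `<=` B ->
    fine (P A) <= fine (P B).
  by move=> mA mB AB; rewrite fine_le ?Pfin// le_measure ?inE.
split.
- by move=> A mA; rewrite lee_fin Psi_ge0// fine_ge0.
- by move=> A B mA mB AB; rewrite lee_fin Psi_homo// Ple.
- move=> A B mA mB.
  have mU := measurableU _ _ mA mB; have mI := measurableI _ _ mA mB.
  rewrite -!EFinD lee_fin Psi_submodular// ?Ple//.
  rewrite -!fineD ?Pfin//; congr fine.
  by rewrite measureUfinl// ?(le_lt_trans _ PT) ?le_measure ?inE// subeK// Pfin.
- move=> F mF FS; have mUF := bigcup_measurable (fun n _ => mF n).
  have ndF : nondecreasing_seq F.
    by move=> i j ij; apply/subsetPset; exact: subset_homo ij.
  have cvgP : fine (P (F n)) @[n --> \oo] --> fine (P (\bigcup_n F n)).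
    apply: fine_cvg; rewrite fineK ?Pfin//.
    exact: nondecreasing_cvg_mu.
  have cvgPsi : (Psi p (fine (P (F n))))%:E @[n --> \oo] -->
      (Psi p (fine (P (\bigcup_n F n))))%:E.
    apply: cvg_EFin; first exact: nearW.
    by apply: continuous_cvg => //; exact: Psi_continuous.
  rewrite -(cvg_lim (@ereal_hausdorff R) cvgPsi).
  rewrite (cvg_lim (@ereal_hausdorff R) (ereal_nondecreasing_cvgn _))//.
  move=> i j ij; rewrite lee_fin Psi_homo// Ple//.
  exact: subset_homo ij.
Qed.

(** * Risks as two-class integrals of a pointwise loss *)

Section two_class_risk.
Context {R : realType} {X : pointedMetricType R}.
Variable mu : probability (borel X * bool)%type R.
Implicit Types f : borel X -> set (borel X) -> \bar R.
Local Open Scope ereal_scope.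

(** Common shape of all three risks: class 0 pays the loss of [A], class 1 that of its
    complement. *)
Definition two_class_risk f (A : set (borel X)) : \bar R :=
  \int[rho_ mu false]_x f x A + \int[rho_ mu true]_x f x (~` A).

Lemma rho_lty i : rho_ mu i setT < +oo.
Proof.
have mX : measurable ([set: borel X] `*` [set i]).
  by apply: measurableX => //.
by rewrite /rho_ (le_lt_trans (probability_le1 mu mX))// ltry.
Qed.

Lemma le_two_class_risk f g A : measurable A ->
  (forall B, measurable B -> measurable_fun setT (f ^~ B)) ->
  (forall B, measurable B -> measurable_fun setT (g ^~ B)) ->
  (forall x B, measurable B -> 0 <= f x B) ->
  (forall x B, measurable B -> f x B <= g x B) ->
  two_class_risk f A <= two_class_risk g A.
Proof.
move=> mA mf mg f0 fg; have mA' := measurableC mA.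
by apply: leeD; apply: ge0_le_integral => //;
  try (by move=> x _; apply: f0); try exact: mf; try exact: mg;
  by move=> x _; apply: fg.
Qed.

Lemma two_class_risk_lty f A : measurable A ->
  (forall B, measurable B -> measurable_fun setT (f ^~ B)) ->
  (forall x B, measurable B -> 0 <= f x B <= 1) ->
  two_class_risk f A < +oo.
Proof.
move=> mA mf f01.
apply: (@le_lt_trans _ _ (two_class_risk (fun _ _ => 1) A)).
  by apply: le_two_class_risk => // x B mB; have /andP[] := f01 x B mB.
rewrite /two_class_risk !integral_cst// !mul1e.
by apply: lte_add_pinfty; exact: rho_lty.
Qed.

(** Reduces existence and convergence to pointwise conditions on the losses. Equality with two-class
    risks is asked on measurable sets, where [prob_riskE] provides it. *)
Lemma two_class_risk_cvg_at_right (f : R -> borel X -> set (borel X) -> \bar R)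
    f0 (J : R -> set (borel X) -> \bar R) J0 :
  (forall p, (0 < p)%R ->
    forall A, measurable A -> J p A = two_class_risk (f p) A) ->
  (forall A, measurable A -> J0 A = two_class_risk f0 A) ->
  (forall p A, (0 < p)%R -> measurable A -> measurable_fun setT (f p ^~ A)) ->
  (forall A, measurable A -> measurable_fun setT (f0 ^~ A)) ->
  (forall p x, (0 < p)%R -> capacity (f p x)) ->
  (forall p q x A, (0 < q)%R -> (q <= p)%R -> measurable A ->
    f p x A <= f q x A) ->
  (forall p x A, (0 < p)%R -> measurable A -> f p x A <= f0 x A) ->
  (forall x A, measurable A ->
    f0 x A <= ereal_sup (range (fun n => f n.+1%:R^-1%R x A))) ->
  (forall x A, measurable A -> f0 x A <= 1) ->
  [/\ forall p, (0 < p)%R -> attains_min (J p), attains_min J0 &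
      min_val (J p) @[p --> (0 : R)%R^'+] --> min_val J0].
Proof.
move=> JE J0E mf mf0 fc f_anti ff0 f0sup f0_le1.
have f_ge0 p x A : (0 < p)%R -> measurable A -> 0 <= f p x A.
  by move=> p0 mA; have [+ _ _ _] := fc p x p0; exact.
have f0_ge0 x A : measurable A -> 0 <= f0 x A.
  by move=> mA; rewrite (le_trans (f_ge0 1%R x A _ mA))// ff0.
have inv_gt0 n : (0 < n.+1%:R^-1 :> R)%R by rewrite invr_gt0.
have eq_attains (J1 J2 : set (borel X) -> \bar R) :
    (forall A, measurable A -> J1 A = J2 A) ->
    attains_min J2 -> attains_min J1.
  move=> J12 [A mA AJ]; exists A => // B mB.
  by rewrite !J12// AJ.
have eq_min (J1 J2 : set (borel X) -> \bar R) :
    (forall A, measurable A -> J1 A = J2 A) ->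
    min_val J1 = min_val J2.
  by move=> J12; congr ereal_inf; apply: eq_imagel => A mA; exact: J12.
have [||||||Ha H0 Hc] := @min_val_cvg_at_right R X
  (fun p => two_class_risk (f p)) (two_class_risk f0).
- move=> p p0.
  have Ic i : capacity (fun A => \int[rho_ mu i]_x f p x A).
    by apply: integral_capacity => [A mA|x]; [exact: mf|exact: fc].
  have [_ _ sub0 _] := Ic false; have [_ _ sub1 _] := Ic true.
  split; first exact: submodular_add_compl sub0 sub1.
    exact: lsc_bigcup_add_compl (Ic false) (Ic true).
  exact: lsc_bigcap_add_compl (Ic false) (Ic true).
- move=> p A p0 mA; have mA' := measurableC mA.
  by apply: adde_ge0; apply: integral_ge0 => x _; exact: f_ge0.
- move=> p q A q0 qp mA; have p0 := lt_le_trans q0 qp.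
  apply: le_two_class_risk => // [B mB|B mB|x B mB|x B mB].
  + exact: mf.
  + exact: mf.
  + exact: f_ge0.
  + exact: f_anti.
- move=> p A p0 mA; apply: le_two_class_risk => // [B mB|x B mB|x B mB].
  + exact: mf.
  + exact: f_ge0.
  + exact: ff0.
- move=> A mA; have mA' := measurableC mA.
  have ndf x B : measurable B ->
      nondecreasing_seq (fun n => f n.+1%:R^-1%R x B).
    by move=> mB i j ij; apply: f_anti => //; rewrite lef_pV2 ?posrE// ler_nat.
  have le_sup i B : measurable B -> \int[rho_ mu i]_x f0 x B <=
      ereal_sup (range (fun n => \int[rho_ mu i]_x f n.+1%:R^-1%R x B)).
    move=> mB; apply: (@le_integral_sup _ _ _ _ (f0 ^~ B)
      (fun n => f n.+1%:R^-1%R ^~ B)) => [|n|x|n x|x|x].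
    - exact: mf0.
    - exact: mf.
    - exact: f0_ge0.
    - exact: f_ge0.
    - exact: ndf.
    - exact: f0sup.
  apply: (le_trans (leeD (le_sup false A mA) (le_sup true _ mA'))).
  rewrite ereal_supD_nondecreasing//.
  + move=> i j ij; apply: ge0_le_integral => // [x _|||x _];
      [exact: f_ge0|exact: mf|exact: mf|exact: ndf].
  + move=> i j ij; apply: ge0_le_integral => // [x _|||x _];
      [exact: f_ge0|exact: mf|exact: mf|exact: ndf].
  + by move=> n; apply: integral_ge0 => x _; exact: f_ge0.
  + by move=> n; apply: integral_ge0 => x _; exact: f_ge0.
- apply: two_class_risk_lty => // x B mB.
  by rewrite f0_ge0// f0_le1.
split.
- by move=> p p0; exact: eq_attains (JE p p0) (Ha p p0).
- exact: eq_attains J0E H0.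
- rewrite (eq_min _ _ J0E).
   apply: cvg_trans Hc; apply: near_eq_cvg.
  (* Equality of the minima is available for positive [p], hence eventually in the limit from the
     right. *)
  near=> p; apply/esym/eq_min/JE.
  by near: p; exact: nbhs_right_gt.
Unshelve. all: by end_near. Qed.

End two_class_risk.

(** * Borel measurability of balls and supports *)

Section supports.
Context {R : realType} {X : pointedMetricType R}.
Local Open Scope ereal_scope.

Lemma open_metric_ball (x : X) (e : R) : open (ball x e).
Proof.
rewrite openE => y; rewrite ballEmdist /= => xy; apply/nbhs_ballP.
exists (e - mdist x y)%R; first by rewrite /= subr_gt0.
move=> z; rewrite !ballEmdist /= => yz.
by rewrite (le_lt_trans (metric_triangle _ y _))// -ltrBrDl.
Qed.

Lemma measurable_open (U : set X) : open U -> measurable (U : set (borel X)).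
Proof. by move=> oU; exact: sub_sigma_algebra. Qed.

(** The complement is the union of all open null sets: possibly an uncountable union, but open. *)
Lemma measurable_supp (nu : {measure set (borel X) -> \bar R}) :
  measurable (supp nu : set (borel X)).
Proof.
rewrite -[supp nu]setCK; apply: measurableC; apply: measurable_open.
have -> : ~` supp nu = \bigcup_(U in [set U | open U /\ nu U = 0]) U.
  apply/seteqP; split=> [x|x [U /= [oU U0] Ux] /(_ U oU Ux)]; last first.
    by rewrite U0 ltxx.
  move=> /existsNP[U] /not_implyP[oU] /not_implyP[Ux] /negP.
  rewrite -leNgt measure_le0 => /eqP U0.
  by exists U.
by apply: bigcup_open => U [].
Qed.

End supports.

(** * Pointwise losses of the three risks and their comparison *)

Section losses.
Context {R : realType} {X : pointedMetricType R}.
Variable m : R.-pker (borel X) ~> (borel X).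
Implicit Types (psi : R -> R) (x : borel X) (A B : set (borel X)).
Local Open Scope ereal_scope.

Definition risk_loss psi x A := (psi (fine (m x A)))%:E.

(** The value 1 on [A] absorbs the two misclassification terms of [prob_risk]. *)
Definition prob_risk_loss psi x A := if x \in A then 1 else risk_loss psi x A.

Definition adv_loss (eps : R) x A : \bar R :=
  ereal_sup [set (\1_A y)%:E | y in ball (x : X) eps].

Lemma pker_fine_ge0 x A : (0 <= fine (m x A))%R.
Proof. by rewrite fine_ge0. Qed.
Hint Resolve pker_fine_ge0 : core.

Lemma pker_fin_num x A : measurable A -> m x A \is a fin_num.
Proof.
move=> mA; rewrite ge0_fin_numE// (@le_lt_trans _ _ 1)// ?ltry//.
by rewrite -(@prob_kernel _ _ _ _ _ m x) le_measure ?inE.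
Qed.

Lemma measurable_risk_loss psi A : {homo psi : s t / (s <= t)%R} ->
  measurable A -> measurable_fun setT (risk_loss psi ^~ A).
Proof.
move=> psi_nd mA; apply/measurable_EFinP.
apply: (measurableT_comp (nondecreasing_measurable measurableT psi_nd)).
by apply: measurableT_comp => //; exact: measurable_kernel.
Qed.

Lemma measurable_prob_risk_loss psi A : {homo psi : s t / (s <= t)%R} ->
  measurable A -> measurable_fun setT (prob_risk_loss psi ^~ A).
Proof.
move=> psi_nd mA; apply: measurable_fun_ifT => //.
  apply: (measurable_fun_bool true); rewrite setTI.
  rewrite [X in measurable X](_ : _ = A)//.
  by apply/seteqP; split=> x /=; [move/set_mem|move/mem_set].
exact: measurable_risk_loss.
Qed.

Lemma prob_riskE (mu : {measure set (borel X * bool)%type -> \bar R}) psi A :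
  {homo psi : s t / (s <= t)%R} -> (forall t, 0 <= t -> 0 <= psi t)%R ->
  measurable A ->
  prob_risk mu m psi A = \int[rho_ mu false]_x prob_risk_loss psi x A +
    \int[rho_ mu true]_x prob_risk_loss psi x (~` A).
Proof.
move=> psi_nd psi_ge0 mA.
(* Splitting the space into [B] and its complement separates the constant 1 from [psi]; this is used
   for [A] and for its complement. *)
have int_loss i B : measurable B -> \int[rho_ mu i]_x prob_risk_loss psi x B =
    rho_ mu i B + \int[rho_ mu i]_(x in ~` B) (psi (fine (m x B)))%:E.
  move=> mB; rewrite -(setUv B) ge0_integral_setU//.
  - congr (_ + _).
      rewrite -[RHS]mul1e -integral_cst//; apply: eq_integral => x xB.
      by rewrite /prob_risk_loss xB.
    apply: eq_integral => x; rewrite inE => xB.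
    by rewrite /prob_risk_loss memNset.
  - exact: measurableC.
  - by rewrite setUv; exact: measurable_prob_risk_loss.
  - move=> x _; rewrite /prob_risk_loss; case: ifPn => // _.
    by rewrite lee_fin psi_ge0.
  - exact/disj_setPCl.
rewrite /prob_risk !int_loss ?setCK//; last exact: measurableC.
by rewrite -addeA addeACA.
Qed.

Lemma adv_loss_ge0 eps x A : (0 < eps)%R -> 0 <= adv_loss eps x A.
Proof.
move=> e0; apply: (@le_trans _ _ (\1_A x)%:E); first by rewrite lee_fin.
by apply: ereal_sup_ubound; exists x => //; exact: ballxx.
Qed.

Lemma adv_loss_ge1 eps x A y : ball (x : X) eps y -> A y ->
  1 <= adv_loss eps x A.
Proof.
move=> xy Ay; apply: ereal_sup_ubound; exists y => //.
by rewrite indicE mem_set.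
Qed.

Lemma adv_loss_le1 eps x A : adv_loss eps x A <= 1.
Proof.
by apply: ge_ereal_sup => _ [y _ <-]; rewrite lee_fin indicE; case: (_ \in _).
Qed.

Lemma adv_loss_le0 eps x A : ball (x : X) eps `<=` ~` A ->
  adv_loss eps x A <= 0.
Proof.
by move=> xA; apply: ge_ereal_sup => _ [y /xA nAy <-]; rewrite indicE memNset.
Qed.

(** By symmetry of the distance the loss is the indicator of the union of the balls centred in [A],
    an open set. *)
Lemma measurable_adv_loss eps A : (0 < eps)%R ->
  measurable_fun setT (adv_loss eps ^~ A).
Proof.
move=> e0; pose U := \bigcup_(y in A) ball (y : X) eps.
have mU : measurable (U : set (borel X)).
  by apply: measurable_open; apply: bigcup_open => y _; exact: open_metric_ball.
rewrite (_ : adv_loss eps ^~ A = fun x => (\1_U x)%:E).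
  by apply/measurable_EFinP; exact: measurable_indic.
apply/funext => x; apply/eqP; rewrite indicE eq_le.
have [|] := boolP (x \in U); rewrite ?inE ?notin_setE => xU.
  rewrite adv_loss_le1/=; case: xU => y Ay yx.
  by apply: adv_loss_ge1 Ay; exact: ball_sym.
rewrite adv_loss_ge0// andbT; apply: adv_loss_le0 => y xy Ay.
by apply: xU; exists y => //; exact: ball_sym.
Qed.

Lemma risk_loss_Psi0_le1 x A : risk_loss Psi0 x A <= 1.
Proof. by rewrite /risk_loss /Psi0 lee_fin; case: (_ < _)%R. Qed.

Lemma prob_risk_loss_Psi0_le1 x A : prob_risk_loss Psi0 x A <= 1.
Proof.
by rewrite /prob_risk_loss; case: ifPn => // _; exact: risk_loss_Psi0_le1.
Qed.

Lemma risk_le_prob_risk_loss x A :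
  risk_loss Psi0 x A <= prob_risk_loss Psi0 x A.
Proof.
by rewrite /prob_risk_loss; case: ifPn => // _; exact: risk_loss_Psi0_le1.
Qed.

(** If the ball meets [A], the right side is 1; otherwise [A] lies outside the ball and [m x A]
    vanishes. *)
Lemma prob_risk_loss_le_adv eps x A : (0 < eps)%R -> measurable A ->
  m x (~` ball (x : X) eps) = 0 -> prob_risk_loss Psi0 x A <= adv_loss eps x A.
Proof.
move=> e0 mA mball; rewrite /prob_risk_loss; case: ifPn => [|_].
  by rewrite inE => Ax; apply: adv_loss_ge1 Ax; exact: ballxx.
have [[y xy Ay]|nA] := pselect (exists2 y, ball (x : X) eps y & A y).
  exact: le_trans (risk_loss_Psi0_le1 _ _) (adv_loss_ge1 xy Ay).
suff mA0 : m x A = 0.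
  by rewrite /risk_loss mA0 /Psi0 ltxx adv_loss_ge0.
apply/eqP; rewrite -measure_le0 -mball le_measure ?inE//.
  by apply: measurableC; exact: measurable_borel_ball.
by move=> y Ay xy; apply: nA; exists y.
Qed.

End losses.

(** * Turning a set into an adversarially robust one at no extra cost *)

Section adversarial_modification.
Context {R : realType} {X : pointedMetricType R}.
Variables (mu : probability (borel X * bool)%type R).
Variables (m : R.-pker (borel X) ~> (borel X)) (eps : R).
Hypothesis rho_supp : rho mu (~` supp (rho mu)) = 0%E.
Hypothesis eps_gt0 : 0 < eps.
Hypothesis ball_supp :
  forall x, supp (rho mu) x -> ball (x : X) eps `<=` supp (m x).
Hypothesis m_ac : forall x, supp (rho mu) x -> forall x', supp (rho mu) x' ->
  mrestr (m x') (measurable_borel_ball x eps) `<< m x.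
Implicit Types (f g : borel X -> set (borel X) -> \bar R) (A B : set (borel X)).
Local Open Scope ereal_scope.

(** Each [rho_ mu i] is dominated by [rho mu], so the complement of the support is null for both
    classes and the comparison holds almost everywhere. *)
Lemma le_two_class_risk_supp f g A B :
  (forall x, 0 <= f x A) -> (forall x, 0 <= f x (~` A)) ->
  (forall x, 0 <= g x B) -> (forall x, 0 <= g x (~` B)) ->
  measurable_fun setT (f ^~ A) -> measurable_fun setT (f ^~ (~` A)) ->
  measurable_fun setT (g ^~ B) -> measurable_fun setT (g ^~ (~` B)) ->
  (forall x, supp (rho mu) x -> f x A <= g x B) ->
  (forall x, supp (rho mu) x -> f x (~` A) <= g x (~` B)) ->
  two_class_risk mu f A <= two_class_risk mu g B.
Proof.
have mS : measurable (~` supp (rho mu) : set (borel X)).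
  by apply: measurableC; exact: measurable_supp.
have ae_supp i (h k : borel X -> \bar R) :
    (forall x, supp (rho mu) x -> h x <= k x) ->
    \forall x \ae rho_ mu i, setT x -> h x <= k x.
  move=> hk; exists (~` supp (rho mu)); split=> //.
    apply/eqP; rewrite -measure_le0 -rho_supp.
    rewrite /rho measure_addE; case: i; first by rewrite leeDr.
    by rewrite leeDl.
  by move=> x /= /not_implyP[_ nhk] /hk.
move=> f0 f0' g0 g0' mf mf' mg mg' fg fg'.
apply: leeD; apply: ae_ge0_le_integral => //; exact: ae_supp.
Qed.

Definition full_mass_points A := [set x | supp (rho mu) x /\ m x (~` A) = 0].

Definition fattening A : set (borel X) :=
  \bigcup_(x in full_mass_points A) ball (x : X) eps.

Lemma measurable_fattening A : measurable (fattening A).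
Proof.
by apply: measurable_open; apply: bigcup_open => x _; exact: open_metric_ball.
Qed.

(* On the open set [ball x eps `&` ball x' eps] both [A] and its complement
   would be negligible for [m x']. *)
Lemma disjoint_balls A x x' : measurable A ->
  supp (rho mu) x -> supp (rho mu) x' -> m x A = 0 -> m x' (~` A) = 0 ->
  ball (x : X) eps `&` ball (x' : X) eps = set0.
Proof.
move=> mA Sx Sx' mxA mx'A; rewrite -subset0 => y [xy x'y].
(* Absolute continuity on the ball around [x] carries the null set [A] from [m x] to [m x']. *)
have mx'xA : m x' (A `&` ball (x : X) eps) = 0.
  exact: (null_content_dominatesP _ _).1 (m_ac Sx Sx') A mA mxA.
pose U : set X := ball x eps `&` ball x' eps.
have oU : open U by apply: openI; exact: open_metric_ball.
(* [y] lies in the support of [m x'], so its neighbourhood [U] would have positive mass; covering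
   [U] by two null sets refutes this. *)
have := ball_supp Sx' x'y oU (conj xy x'y).
apply/negP; rewrite -leNgt.
have mxA' : measurable (A `&` (ball (x : X) eps : set (borel X))).
  by apply: measurableI => //; exact: measurable_borel_ball.
apply: (@le_trans _ _ (m x' ((A `&` ball (x : X) eps) `|` ~` A))).
  rewrite le_measure ?inE//; first exact: measurable_open.
    by apply: measurableU => //; exact: measurableC.
  by move=> z [xz _]; have [|] := pselect (A z); [left|right].
apply: (le_trans (measureU2 _ mxA' (measurableC mA))).
by rewrite [X in X + _]mx'xA [X in _ + X]mx'A adde0.
Qed.

(** Wherever the [Psi0] loss vanishes, the ball lies entirely on the correct side of the
    fattening. *)
Lemma adv_fattening_le A : measurable A ->
  two_class_risk mu (adv_loss eps) (fattening A) <=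
  two_class_risk mu (risk_loss m Psi0) A.
Proof.
move=> mA; have mA' := measurableC mA.
have loss_ge0 x B : 0 <= risk_loss m Psi0 x B by rewrite lee_fin ler0n.
(* If [m x C] is not 0, the [Psi0] loss is 1 and bounds any adversarial loss; only the null case
   remains. *)
have adv_le x B C : measurable C ->
    (m x C = 0 -> ball (x : X) eps `<=` ~` B) ->
    adv_loss eps x B <= risk_loss m Psi0 x C.
  move=> mC xB; have [/xB/adv_loss_le0/le_trans->//|mxC] := eqVneq (m x C) 0.
  rewrite /risk_loss /Psi0 fine_gt0; first exact: adv_loss_le1.
  by rewrite lt0e mxC measure_ge0 -ge0_fin_numE// pker_fin_num.
apply: le_two_class_risk_supp => //; try by move=> x; exact: adv_loss_ge0.
- exact: measurable_adv_loss.
- exact: measurable_adv_loss.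
- by apply: measurable_risk_loss => //; exact: Psi0_homo.
- by apply: measurable_risk_loss => //; exact: Psi0_homo.
(* Class 0: a point of the fattening in this ball would lie in two balls that [disjoint_balls]
   separates. *)
- move=> x Sx; apply: adv_le => // mxA y xy [x' [Sx' mx'A] x'y].
  have := disjoint_balls mA Sx Sx' mxA mx'A.
  by rewrite -subset0 => /(_ y (conj xy x'y)).
(* Class 1: [x] is itself a full mass point, so its ball is part of the fattening. *)
- move=> x Sx; apply: adv_le => // mxA y xy; rewrite setCK.
  by exists x.
Qed.

End adversarial_modification.

Theorem theorem6 (R : realType) (X : pointedMetricType R)
    (mu : probability (borel X * bool)%type R)
    (m : R.-pker (borel X) ~> (borel X))
    (eps : R)
    (rho_supp : rho mu (~` supp (rho mu)) = 0%E)
    (eps_gt0 : 0 < eps)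
    (m_ball : forall x, supp (rho mu) x -> m x (~` ball (x : X) eps) = 0%E)
    (ball_supp : forall x, supp (rho mu) x -> ball (x : X) eps `<=` supp (m x))
    (m_ac : forall x, supp (rho mu) x -> forall x', supp (rho mu) x' ->
      mrestr (m x') (measurable_borel_ball x eps) `<< m x) :
  [/\ forall p : R, 0 < p -> attains_min (risk mu m (Psi p)),
      attains_min (risk mu m Psi0),
      attains_min (adv_risk mu eps),
      min_val (risk mu m (Psi p)) @[p --> (0 : R)^'+]
        --> min_val (risk mu m Psi0) &
      min_val (risk mu m Psi0) = min_val (adv_risk mu eps)] /\
  [/\ forall p : R, 0 < p -> attains_min (prob_risk mu m (Psi p)),
      attains_min (prob_risk mu m Psi0),
      attains_min (adv_risk mu eps),
      min_val (prob_risk mu m (Psi p)) @[p --> (0 : R)^'+]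
        --> min_val (prob_risk mu m Psi0) &
      min_val (prob_risk mu m Psi0) = min_val (adv_risk mu eps)].
Proof.
have Psi0_ge0 t : 0 <= t -> 0 <= Psi0 t :> R by move=> _; exact: ler0n.
have fine_m_ge0 x A : 0 <= fine (m x A) by exact: pker_fine_ge0.
have loss_cap p x : 0 < p -> capacity (risk_loss m (Psi p) x).
  by move=> p0; apply: Psi_capacity => //; rewrite prob_kernel ltry.
have loss_le1 p x A : (risk_loss m (Psi p) x A <= 1)%E.
  by rewrite lee_fin Psi_le1.
(* For [risk] the two-class form holds by definition, hence [erefl]; for [prob_risk] below it comes
   from [prob_riskE]. *)
have [min_p min_0 cvg_0] := @two_class_risk_cvg_at_right R X mu
  (fun p => risk_loss m (Psi p)) (risk_loss m Psi0)
  (fun p => risk mu m (Psi p)) (risk mu m Psi0)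
  (fun p _ A _ => erefl) (fun A _ => erefl)
  (fun p A p0 => measurable_risk_loss m (Psi_homo p0))
  (fun A => measurable_risk_loss m (@Psi0_homo R))
  (fun p x p0 => loss_cap p x p0)
  (fun p q x A q0 qp _ => Psi_anti q0 qp (fine_m_ge0 x A))
  (fun p x A p0 _ => Psi_le_Psi0 p0 (fine_m_ge0 x A))
  (fun x A _ => Psi0_le_sup (fine_m_ge0 x A))
  (fun x A _ => risk_loss_Psi0_le1 m x A).
have [|||||||||pmin_p pmin_0 pcvg_0] := @two_class_risk_cvg_at_right R X mu
  (fun p => prob_risk_loss m (Psi p)) (prob_risk_loss m Psi0)
  (fun p => prob_risk mu m (Psi p)) (prob_risk mu m Psi0).
- move=> p p0 A mA; apply: prob_riskE => //; first exact: Psi_homo.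
  by move=> t; exact: Psi_ge0.
- by move=> A mA; apply: prob_riskE => //; exact: Psi0_homo.
- by move=> p A p0 mA; apply: measurable_prob_risk_loss => //; exact: Psi_homo.
- by move=> A mA; apply: measurable_prob_risk_loss => //; exact: Psi0_homo.
- by move=> p x p0; apply: capacity_mem => //; exact: loss_cap.
- move=> p q x A q0 qp mA; rewrite /prob_risk_loss; case: ifPn => // _.
  by rewrite lee_fin Psi_anti.
- move=> p x A p0 mA; rewrite /prob_risk_loss; case: ifPn => // _.
  by rewrite lee_fin Psi_le_Psi0.
- move=> x A mA; rewrite /prob_risk_loss; case: ifPn => // _.
    by apply: ereal_sup_ubound; exists 0%N.
  exact: Psi0_le_sup.
- by move=> x A mA; exact: prob_risk_loss_Psi0_le1.
have risk_le_prob A : measurable A ->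
    (risk mu m Psi0 A <= prob_risk mu m Psi0 A)%E.
  move=> mA; rewrite prob_riskE//; last exact: Psi0_homo.
  apply: (@le_two_class_risk _ _ mu (risk_loss m Psi0)) => //.
  + by move=> B; apply: measurable_risk_loss; exact: Psi0_homo.
  + by move=> B; apply: measurable_prob_risk_loss; exact: Psi0_homo.
  + by move=> x B _; rewrite lee_fin Psi0_ge0.
  + by move=> x B _; exact: risk_le_prob_risk_loss.
have prob_le_adv A : measurable A ->
    (prob_risk mu m Psi0 A <= adv_risk mu eps A)%E.
  move=> mA; have mA' := measurableC mA.
  have prob_ge0 x B : (0 <= prob_risk_loss m Psi0 x B)%E.
    by rewrite /prob_risk_loss; case: ifPn => // _; rewrite lee_fin Psi0_ge0.
  rewrite prob_riskE//; last exact: Psi0_homo.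
  apply: (@le_two_class_risk_supp _ _ mu rho_supp
    (prob_risk_loss m Psi0) (adv_loss eps)) => //.
  + by move=> x; exact: adv_loss_ge0.
  + by move=> x; exact: adv_loss_ge0.
  + by apply: measurable_prob_risk_loss => //; exact: Psi0_homo.
  + by apply: measurable_prob_risk_loss => //; exact: Psi0_homo.
  + exact: measurable_adv_loss.
  + exact: measurable_adv_loss.
  + by move=> x Sx; apply: prob_risk_loss_le_adv => //; exact: m_ball.
  + by move=> x Sx; apply: prob_risk_loss_le_adv => //; exact: m_ball.
have min_risk_le_prob :
    (min_val (risk mu m Psi0) <= min_val (prob_risk mu m Psi0))%E.
  apply: le_ereal_inf_tmp => _ [A mA <-].
  exact: le_trans (min_val_le _ mA) (risk_le_prob A mA).
have min_prob_le_adv :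
    (min_val (prob_risk mu m Psi0) <= min_val (adv_risk mu eps))%E.
  apply: le_ereal_inf_tmp => _ [A mA <-].
  exact: le_trans (min_val_le _ mA) (prob_le_adv A mA).
(* The fattening of a minimizer [A] closes the cycle of inequalities between the three minima, and
   so attains the adversarial one. *)
have [A mA A_min] := min_0.
have mA' := measurable_fattening mu m eps A.
have advA' :
    (adv_risk mu eps (fattening mu m eps A) <= min_val (risk mu m Psi0))%E.
  apply: (le_trans (adv_fattening_le rho_supp eps_gt0 ball_supp m_ac mA)).
  by apply: le_ereal_inf_tmp => _ [B mB <-]; exact: A_min.
have min_adv_le : (min_val (adv_risk mu eps) <= min_val (risk mu m Psi0))%E.
  exact: le_trans (min_val_le _ mA') advA'.
have min_adv : attains_min (adv_risk mu eps).
  apply: (attains_minP mA'); apply: (le_trans advA').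
  exact: le_trans min_risk_le_prob min_prob_le_adv.
split; split=> //; apply/eqP; rewrite eq_le.
  by rewrite min_adv_le andbT (le_trans min_risk_le_prob).
by rewrite min_prob_le_adv (le_trans min_adv_le).
Qed.
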